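(* Let $n,k\ge 1$. A classical Turing machine $T$ (with alphabet $\Sigma$ and state set $Q$) is reversible if and only if it is of the form $T=T_1\circ T_0$, where $T_0$ is a state-symbol permutation and $T_1$ is a state-dependent shift.
   Context: Let $\Sigma=\{0,\dots,n-1\}$, $Q=\{1,\dots,k\}$. Let $X_k=\{y\in\{0,1,\dots,k\}^{\mathbb{Z}} : y_u\ne0\text{ and }y_v\neq 0\implies u=v\}$ and $X_{n,k}=\Sigma^{\mathbb{Z}}\times X_k$. Given finite $F,F'\subset\mathbb{Z}$ and $f:\Sigma^F\times Q\to\Sigma^{F'}\times Q\times\mathbb{Z}$, the (moving head) Turing machine $T_f:X_{n,k}\to X_{n,k}$ is defined by: $T_f(x,y)=(x,y)$ if $y$ is identically $0$; otherwise let $v$ be the unique position with $q=y_v\ne 0$, let $p\in\Sigma^F$ with $p_u=x_{v+u}$, and let $f(p,q)=(p',q',e)$; then $T_f(x,y)=(\tilde x,\tilde y)$ with $\tilde x_t=p'_{t-v}$ if $t-v\in F'$, $\tilde x_t=x_t$ otherwise, and $\tilde y_{v+e}=q'$, $\tilde y_t=0$ for $t\ne v+e$. $T_f$ is reversible if it has a two-sided inverse (under composition) which is also a Turing machine in this sense (for some $F,F'$ and local rule). A classical Turing machine is a Turing machine $T_f$ given by a local rule with $F=F'=\{0\}$ and moves in $\{-1,0,1\}$, i.e. $f:\Sigma\times Q\to\Sigma\times Q\times\{-1,0,1\}$. A state-symbol permutation is a Turing machine with local rule $f(a,q)=(b,r,0)$, where $(a,q)\mapsto(b,r)$ is a permutation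 of $\Sigma\times Q$. A state-dependent shift is a Turing machine which never modifies the tape or the state, and moves the head by a vector in $\{-1,0,1\}$ depending only on the state: its local rule is $f(a,q)=(a,q,\delta(q))$ for some $\delta:Q\to\{-1,0,1\}$. *)

(* Defs.v *)
From mathcomp Require Import all_boot all_order all_algebra all_fingroup.
From mathcomp Require Import finmap boolp.

Set Implicit Arguments.
Unset Strict Implicit.
Unset Printing Implicit Defensive.

Import GRing.Theory.
Local Open Scope ring_scope.

(* The symbols are 'I_n and the states are 'I_k (a relabelling of {1, .., k}).
   A cell of the head track is an [option 'I_k], with [None] in the role of the
   value 0 ("no head here") and [Some q] that of the state q. *)
Definition at_most_one_head (k : nat) (y : int -> option 'I_k) : Prop :=
  forall u v : int, y u <> None -> y v <> None -> u = v.

Record head_track (k : nat) := HeadTrack {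
  head_at :> int -> option 'I_k;
  head_atP : at_most_one_head head_at }.

Definition config (n k : nat) : Type := ((int -> 'I_n) * head_track k)%type.

Definition single_head_fun (k : nat) (v : int) (q : 'I_k) : int -> option 'I_k :=
  fun t => if t == v then Some q else None.

Lemma single_headP (k : nat) (v : int) (q : 'I_k) :
  at_most_one_head (single_head_fun v q).
Proof. by move=> u w; rewrite /single_head_fun; do 2 case: eqP => // ->. Qed.

Definition single_head (k : nat) (v : int) (q : 'I_k) : head_track k :=
  HeadTrack (@single_headP k v q).

Definition local_rule (n k : nat) (F F' : {fset int}) : Type :=
  {ffun F -> 'I_n} * 'I_k -> {ffun F' -> 'I_n} * 'I_k * int.

Definition read_tape (n : nat) (F : {fset int}) (x : int -> 'I_n) (v : int) :
    {ffun F -> 'I_n} :=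
  [ffun u : F => x (v + val u)].

(* [insub (t - v) : option F'] is [Some] exactly when t - v belongs to F'. *)
Definition write_tape (n : nat) (F' : {fset int}) (x : int -> 'I_n) (v : int)
    (p' : {ffun F' -> 'I_n}) : int -> 'I_n :=
  fun t => if insub (t - v) is Some u then p' u else x t.

(* Whether the head track is blank is undecidable, hence the classical test; by
   [head_atP] the pair (v, q) chosen by [cid] is the only one possible. *)
Definition turing (n k : nat) (F F' : {fset int}) (f : local_rule n k F F')
    (c : config n k) : config n k :=
  match pselect (exists vq : int * 'I_k, c.2 vq.1 = Some vq.2) with
  | left ex =>
      let: (v, q) := sval (cid ex) in
      let: (p', q', e) := f (read_tape F c.1 v, q) in
      (write_tape c.1 v p', single_head (v + e) q')
  | right _ => c
  end.

Definition is_turing (n k : nat) (T : config n k -> config n k) : Prop :=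
  exists (F F' : {fset int}) (f : local_rule n k F F'), T = turing f.

Definition reversible (n k : nat) (T : config n k -> config n k) : Prop :=
  exists S : config n k -> config n k, [/\ is_turing S, cancel T S & cancel S T].

(* The local rule with F = F' = {0} given by f, via Sigma^{0} = Sigma. *)
Definition rule0 (n k : nat) (f : 'I_n * 'I_k -> 'I_n * 'I_k * int) :
    local_rule n k [fset 0]%fset [fset 0]%fset :=
  fun pq => let: (b, r, e) := f (pq.1 [` fset11 0]%fset, pq.2) in
            ([ffun => b], r, e).

Definition unit_move (e : int) : Prop := e \in [:: -1; 0; 1].

Definition classical_turing (n k : nat) (T : config n k -> config n k) : Prop :=
  exists f : 'I_n * 'I_k -> 'I_n * 'I_k * int,
    (forall aq, unit_move (f aq).2) /\ T = turing (rule0 f).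

Definition state_symbol_permutation (n k : nat) (T : config n k -> config n k) :
    Prop :=
  exists s : {perm 'I_n * 'I_k}, T = turing (rule0 (fun aq => (s aq, 0))).

Definition state_dependent_shift (n k : nat) (T : config n k -> config n k) :
    Prop :=
  exists delta : 'I_k -> int,
    (forall q, unit_move (delta q)) /\
    T = turing (rule0 (fun aq => (aq, delta aq.2))).

(* Main.v *)
(** If an injective classical machine enters a state [r] through two rules with
    different moves, write the two produced symbols at the two cells the head may
    have come from: the resulting configuration has two preimages. Hence the move
    is a function of the new state, and then the symbol-state part of the rule is
    injective, hence a permutation. Conversely the inverse of a shift after a
    permutation undoes both at once, by rewriting the cell the head came from. *)

Require Import Defs.
From mathcomp Require Import all_boot all_order all_algebra.
From mathcomp Require Import all_fingroup finmap boolp.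

Set Implicit Arguments.
Unset Strict Implicit.
Unset Printing Implicit Defensive.

Import GRing.Theory.

Section Machines.

Local Open Scope ring_scope.

Variables n k : nat.
Implicit Types (x : int -> 'I_n) (y : head_track k) (q : 'I_k) (v : int).

Definition set_cell x v (b : 'I_n) : int -> 'I_n :=
  fun t => if t == v then b else x t.

Lemma set_cellE x v b : set_cell x v b v = b.
Proof. by rewrite /set_cell eqxx. Qed.

Lemma set_set_cell x v b b' : set_cell (set_cell x v b) v b' = set_cell x v b'.
Proof. by apply: funext => t; rewrite /set_cell; case: eqP. Qed.

Lemma set_cell_id x v : set_cell x v (x v) = x.
Proof. by apply: funext => t; rewrite /set_cell; case: eqP => [->|]. Qed.

Lemma single_headE v q : single_head v q v = Some q.
Proof. by rewrite /= /single_head_fun eqxx. Qed.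

Lemma head_track_inj y y' : head_at y =1 head_at y' -> y = y'.
Proof.
case: y y' => [y yP] [y' yP'] /= /funext eqy; rewrite eqy in yP *.
by congr HeadTrack; exact: Prop_irrelevance.
Qed.

Lemma head_track_single y v q : y v = Some q -> y = single_head v q.
Proof.
move=> yv; apply: head_track_inj => t /=; rewrite /single_head_fun.
case: eqP => [-> //|tv]; case yt: (y t) => [r|//].
by case: tv; apply: (head_atP (h := y)); rewrite ?yt ?yv.
Qed.

Lemma single_head_inj v q v' q' :
  single_head v q = single_head v' q' -> v = v' /\ q = q'.
Proof.
move=> eqh; have := single_headE v q.
by rewrite eqh /= /single_head_fun; case: eqP => // -> [->].
Qed.

(** Machines fix the configurations without a head, so identities between machines only need a
    computation on those of the form [(x, single_head v q)]. *)
Lemma config_cases (c : config n k) :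
  (exists x v q, c = (x, single_head v q)) \/ (forall v, c.2 v = None).
Proof.
case: c => x y; case: (pselect (exists v, y v <> None)) => [[v]|nex].
  case yv: (y v) => [q|//] _; left; exists x, v, q.
  by rewrite (head_track_single yv).
by right=> v /=; apply: contrapT => yv; apply: nex; exists v.
Qed.

Lemma turing_single F F' (f : local_rule n k F F') x v q :
  turing f (x, single_head v q) =
  (write_tape x v (f (read_tape F x v, q)).1.1,
   single_head (v + (f (read_tape F x v, q)).2) (f (read_tape F x v, q)).1.2).
Proof.
rewrite /turing; case: pselect => [ex|nex]; last first.
  by case: nex; exists (v, q); rewrite single_headE.
case: (cid ex) => -[v' q'] yv /=.
have /= /single_head_inj [<- <-] := head_track_single yv.
by case: (f _) => [[p' r] e].
Qed.

Lemma turing_blank F F' (f : local_rule n k F F') (c : config n k) :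
  (forall v, c.2 v = None) -> turing f c = c.
Proof.
rewrite /turing => c0; case: pselect => // ex.
by exfalso; case: ex => vq; rewrite c0.
Qed.

Lemma turing_rule0 (f : 'I_n * 'I_k -> 'I_n * 'I_k * int) x v q :
  turing (rule0 f) (x, single_head v q) =
  (set_cell x v (f (x v, q)).1.1,
   single_head (v + (f (x v, q)).2) (f (x v, q)).1.2).
Proof.
rewrite turing_single /rule0 /= ffunE addr0.
case: (f _) => [[b r] e] /=; congr pair; apply: funext => t.
rewrite /write_tape /set_cell; case: insubP => [u|].
  by rewrite in_fset1 subr_eq0 ffunE => ->.
by rewrite in_fset1 subr_eq0 => /negbTE ->.
Qed.

(** The first machine leaves the head in place, so the shift rereads the symbol just written, puts
    it back, and moves according to the new state. *)
Lemma turing_rule0_comp (s : 'I_n * 'I_k -> 'I_n * 'I_k) (delta : 'I_k -> int) :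
  turing (rule0 (fun aq => (aq, delta aq.2))) \o
    turing (rule0 (fun aq => (s aq, 0))) =
  turing (rule0 (fun aq => (s aq, delta (s aq).2))).
Proof.
apply: funext => c /=; case: (config_cases c) => [[x [v [q ->]]]|c0].
  by rewrite !turing_rule0 /= addr0 set_cellE set_set_cell.
by rewrite !turing_blank.
Qed.

Section Injective.

Variable f : 'I_n * 'I_k -> 'I_n * 'I_k * int.
Hypothesis injT : injective (turing (rule0 f)).

Lemma inj_turing_move aq aq' :
  (f aq).1.2 = (f aq').1.2 -> (f aq).2 = (f aq').2.
Proof.
case: aq aq' => [a q] [a' q'] eqr; apply/eqP; apply: contraT => neqe.
set e := (f (a, q)).2 in neqe; set e' := (f (a', q')).2 in neqe.
pose b := (f (a, q)).1.1; pose b' := (f (a', q')).1.1.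
(* The heads start at [- e] and [- e'], so that both land at 0. Each tape carries the symbol to be
   read under its own head and the other rule's output under the other head; after one step both
   tapes have [b] at [- e], [b'] at [- e'] and [a] elsewhere. *)
pose x := set_cell (fun=> a) (- e') b'.
pose x' := set_cell (set_cell (fun=> a) (- e) b) (- e') a'.
have neqN : (- e == - e') = false by rewrite eqr_opp; exact: negbTE.
have xe : x (- e) = a by rewrite /x /set_cell neqN.
have xe' : x' (- e') = a' by rewrite /x' /set_cell eqxx.
suff /injT/(congr1 snd)/single_head_inj [/eqP] :
    turing (rule0 f) (x, single_head (- e) q) =
    turing (rule0 f) (x', single_head (- e') q') by rewrite neqN.
rewrite !turing_rule0 xe xe' -/e -/e' !addNr eqr; congr pair.
apply: funext => t; rewrite /x /x' /set_cell.
by case: (eqVneq t (- e)) => [->|_]; rewrite ?neqN //; case: eqP.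
Qed.

(** Equal outputs contain equal new states, hence come with equal moves; two tapes that differ at
    most under the head then have the same image. *)
Lemma inj_turing_rule : injective (fun aq => (f aq).1).
Proof.
move=> [a q] [a' q'] eqf.
have eqe : (f (a, q)).2 = (f (a', q')).2 by apply: inj_turing_move; rewrite eqf.
have /injT eqc : turing (rule0 f) (fun=> a, single_head 0 q) =
                 turing (rule0 f) (set_cell (fun=> a) 0 a', single_head 0 q').
  by rewrite !turing_rule0 set_cellE set_set_cell eqf eqe.
have /single_head_inj [_ ->] := congr1 snd eqc.
by have /(congr1 (@^~ 0)) := congr1 fst eqc; rewrite /= set_cellE => ->.
Qed.

End Injective.

Section Inverse.

Variables (s : {perm 'I_n * 'I_k}) (delta : 'I_k -> int).

(** The cell that the head came from depends on the current state, whereas the window of a local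
    rule is fixed: it collects all possible offsets. *)
Let F : {fset int} := [fset - delta q | q in 'I_k]%fset.

Let deltaF q : - delta q \in F.
Proof. exact: in_imfset. Qed.

(** The state tells which cell of the window was last written; [s^-1] is applied to its symbol and
    the state, and the other cells are written back unchanged. *)
Let inv_rule : local_rule n k F F := fun pr =>
  let aq := (s^-1)%g (pr.1 [` deltaF pr.2]%fset, pr.2) in
  ([ffun u => if val u == - delta pr.2 then aq.1 else pr.1 u],
   aq.2, - delta pr.2).

Let inv_single x v r :
  let aq := (s^-1)%g (x (v - delta r), r) in
  turing inv_rule (x, single_head v r) =
  (set_cell x (v - delta r) aq.1, single_head (v - delta r) aq.2).
Proof.
rewrite turing_single /inv_rule /= ffunE /=; congr pair.
apply: funext => t; rewrite /write_tape /set_cell.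
case: insubP => [u _ uE|tF].
  by rewrite !ffunE uE subr_eq [- _ + v]addrC [val u]uE subrKC.
(* The rewritten cell lies in the window, so a position outside keeps its symbol on both sides. *)
by case: eqP tF => // ->; rewrite [v - _]addrC addrK deltaF.
Qed.

Lemma perm_shift_reversible :
  reversible (turing (rule0 (fun aq => (s aq, delta (s aq).2)))).
Proof.
exists (turing inv_rule); split; first by exists F, F, inv_rule.
- move=> c; case: (config_cases c) => [[x [v [q ->]]]|c0]; last first.
    by rewrite !turing_blank.
  rewrite turing_rule0 inv_single /= addrK set_cellE set_set_cell.
  by rewrite -surjective_pairing permK set_cell_id.
- move=> c; case: (config_cases c) => [[x [v [q ->]]]|c0]; last first.
    by rewrite !turing_blank.
  rewrite inv_single turing_rule0 /= set_cellE set_set_cell.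
  by rewrite -surjective_pairing permKV /= subrK set_cell_id.
Qed.

End Inverse.

End Machines.

Theorem theorem2 (n k : nat) (hn : 1 <= n) (hk : 1 <= k)
    (T : config n k -> config n k) (hT : classical_turing T) :
  reversible T <->
  exists T0 T1 : config n k -> config n k,
    [/\ state_symbol_permutation T0, state_dependent_shift T1 & T = T1 \o T0].
Proof.
split=> [[S [_ TK _]]|[T0 [T1 [[s ->] [delta [_ ->]] ->]]]]; last first.
  by rewrite turing_rule0_comp; exact: perm_shift_reversible.
case: hT TK => f [f_unit ->] /can_inj injT.
pose s := perm (inj_turing_rule injT).
(* The symbol 0, available by [hn], is an arbitrary choice: all rules entering [q] make the same
   move. *)
pose delta q := (f ((s^-1)%g (Ordinal hn, q))).2.
exists (turing (rule0 (fun aq => (s aq, 0%R)))).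
exists (turing (rule0 (fun aq => (aq, delta aq.2)))).
split; [by exists s | by exists delta; split=> // q; exact: f_unit |].
rewrite turing_rule0_comp; congr (turing (rule0 _)); apply: funext => aq.
rewrite [LHS]surjective_pairing permE; congr pair.
(* Both [aq] and the preimage that defines [delta] at [(s aq).2] lead to the state [(s aq).2]. *)
apply: (inj_turing_move injT).
by rewrite -[in RHS](permE (inj_turing_rule injT)) permKV.
Qed.
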